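(* Let $G$ be a connected graph with vertex set $[n]=\{1,\ldots,n\}$ and let $A=[a_{i,j}]$ be a real symmetric matrix of order $n$. If $A$ is (entrywise) nonnegative, then there is a path $P$ with $V(P)=V(G)$ such that $$\sum_{1\le i<j\le n} d_G(i,j)\,a_{i,j}\le \sum_{1\le i<j\le n} d_P(i,j)\,a_{i,j}.$$
   Context: Graphs are finite, simple and undirected; a graph of order $n$ has vertex set $[n]=\{1,\ldots,n\}$. For a connected graph $G$, $d_G(i,j)$ denotes the distance (number of edges of a shortest path) between the vertices $i$ and $j$ in $G$. A path $P$ with $V(P)=V(G)$ is a graph on the vertex set $[n]$ that is isomorphic to the path graph $P_n$ of order $n$; $P$ need not be a subgraph of $G$. *)

(* Defs.v *)
From mathcomp Require Import all_boot.

Set Implicit Arguments.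
Unset Strict Implicit.
Unset Printing Implicit Defensive.

Record sgraph (T : finType) := SGraph {
  adj :> rel T;
  adj_sym : symmetric adj;
  adj_irrefl : irreflexive adj
}.

Definition connected_graph (T : finType) (G : sgraph T) : Prop :=
  forall x y : T, connect G x y.

(* The length [k] counts edges: the vertices of the path are [x :: p]. *)
Definition has_path (T : finType) (G : sgraph T) (k : nat) (x y : T) : bool :=
  [exists p : k.-tuple T,
     [&& path G x p, uniq (x :: p) & last x p == y]].

(* A path has distinct vertices, hence fewer than #|T| edges, so bounding [k]
   loses nothing; #|T| is a junk value, taken only when no path joins [x]
   and [y]. *)
Definition dist (T : finType) (G : sgraph T) (x y : T) : nat :=
  \big[minn/#|T|]_(k < #|T| | has_path G k x y) k.

Definition graph_iso (T U : finType) (G : sgraph T) (H : sgraph U) : Prop :=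
  exists2 f : T -> U, bijective f & {mono f : x y / G x y >-> H x y}.

Definition path_adj (n : nat) : rel 'I_n :=
  fun i j => (i.+1 == j :> nat) || (j.+1 == i :> nat).

Lemma path_adj_sym n : symmetric (@path_adj n).
Proof. by move=> i j; rewrite /path_adj orbC. Qed.

Lemma path_adj_irrefl n : irreflexive (@path_adj n).
Proof. by move=> i; rewrite /path_adj orbb gtn_eqF. Qed.

Definition path_graph (n : nat) : sgraph 'I_n :=
  SGraph (@path_adj_sym n) (@path_adj_irrefl n).

Definition is_path_graph (n : nat) (P : sgraph 'I_n) : Prop :=
  graph_iso P (path_graph n).

(* Main.v *)
Require Import Defs.
From mathcomp Require Import all_boot all_order all_algebra.
From mathcomp Require Import zify ring lra.
From mathcomp Require Import reals.

Import Order.TTheory GRing.Theory Num.Theory.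
Local Open Scope ring_scope.

(** Among all connected graphs on the given vertices, take an H maximizing
first the A-weighted sum of distances and then, among the maximizers, the
unweighted sum of distances over all pairs. The graph G is one of the
competitors, so it suffices to show that H is a path.

Deleting an edge never shortens a distance and lengthens the one between its
ends; if the deletion kept H connected, it would not decrease the first sum
and would increase the second. Hence every edge of H is a bridge
([extremal_minimal]).

Suppose that a vertex v had three distinct neighbours b1, b2, b3, and let B1,
B2, B3 be the branches hanging from v at these neighbours. Sliding B1 means
replacing the edge v b1 by b1 b2. It brings B1 and B2 closer by 1, moves B1
away by 1 from everything outside B1 and B2, and preserves all other distances
([dist_slide]). Perform separately the three cyclic slides of B1 towards b2,
of B2 towards b3 and of B3 towards b1. For two vertices in distinct branches
Bi and Bj one slide loses 1, another gains 1 and the third changes nothing;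
for a vertex in some Bi and one in no branch, exactly one slide changes their
distance, by +1. So on average over the three slides no distance decreases,
and that between v and b1 increases ([dist_three_slides]). As none of the
three slid graphs has a larger weighted sum than H, all three tie with it, and
then one of them has a larger unweighted sum: a contradiction
([extremal_degree]). The tie-break is what handles weights with zero entries.

Thus H has maximum degree at most 2. A vertex s farthest from an arbitrary one
is a leaf because all edges are bridges ([leaf_exists]); from s each
distance is attained only once, so the distance from s is an isomorphism onto
the standard path ([max_degree2_path]). *)

Set Implicit Arguments.
Unset Strict Implicit.
Unset Printing Implicit Defensive.

(** * Distances in connected graphs *)

Section Distance.
Variables (T : finType) (G : sgraph T).
Local Open Scope nat_scope.

Lemma dist_path_le (x : T) (p : seq T) :
  path G x p -> dist G x (last x p) <= size p.
Proof.
move=> xp; case: (shortenP xp) => q xq uq sub_qp.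
have lt_q : size q < #|T|.
  by rewrite -[(size q).+1]/(size (x :: q)) -(card_uniqP uq) max_card.
apply: (@leq_trans (size q)); last by rewrite uniq_leq_size //; case/andP: uq.
rewrite /dist -minEnat -leEnat.
apply: (@bigmin_le_cond _ nat _ #|T| (Ordinal lt_q) _ (fun k => k : nat)).
apply/existsP; exists (in_tuple q) => /=.
by rewrite xq eqxx andbT.
Qed.

Lemma eq_dist (H : sgraph T) : G =2 H -> dist G =2 dist H.
Proof.
move=> eGH x y; apply: eq_bigl => k; apply: eq_existsb => p.
by rewrite (eq_path eGH).
Qed.

Hypothesis Gconn : connected_graph G.

Lemma dist_lt_card (x y : T) : dist G x y < #|T|.
Proof.
have /connectP[p xp ->] := Gconn x y; case: (shortenP xp) => q xq uq _.
apply: leq_ltn_trans (dist_path_le xq) _.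
by rewrite -[(size q).+1]/(size (x :: q)) -(card_uniqP uq) max_card.
Qed.

Lemma geodesic (x y : T) :
  exists2 p : seq T, path G x p & last x p = y /\ size p = dist G x y.
Proof.
have: dist G x y = #|T| \/ has_path G (dist G x y) x y.
  rewrite {1 2}/dist.
  apply: (big_ind (fun k => k = #|T| \/ has_path G k x y)).
  - by left.
  - by move=> k l Hk Hl; rewrite /minn; case: ifP.
  - by move=> k; right.
case=> [eqd|]; first by have := dist_lt_card x y; rewrite eqd ltnn.
case/existsP=> p /and3P[xp _ /eqP lastp]; exists p => //.
by rewrite size_tuple.
Qed.

Lemma distxx (x : T) : dist G x x = 0.
Proof. by apply/eqP; rewrite -leqn0; apply: (@dist_path_le x [::]). Qed.

Lemma dist_eq0 (x y : T) : dist G x y = 0 -> x = y.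
Proof.
by have [p xp [<- <-]] := geodesic x y; move/size0nil=> ->.
Qed.

Lemma dist_step (x y z : T) : G y z -> dist G x z <= (dist G x y).+1.
Proof.
move=> yz; have [p xp [lastp <-]] := geodesic x y.
have := @dist_path_le x (rcons p z); rewrite rcons_path last_rcons size_rcons.
by apply; rewrite xp lastp.
Qed.

Lemma dist_pred (x y : T) :
  x != y -> exists2 z, G z y & dist G x y = (dist G x z).+1.
Proof.
have [p] := geodesic x y; case/lastP: p => [|p z] /=.
  by move=> _ [-> _]; rewrite eqxx.
rewrite rcons_path last_rcons size_rcons => /andP[xp pz] [<- sz] _.
exists (last x p) => //; apply/eqP; rewrite eqn_leq dist_step //=.
by rewrite -sz ltnS dist_path_le.
Qed.

(** Distances in a modified graph are bounded below through this lemma: it is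
enough to exhibit a function of the end vertex that grows by at most 1 along
each edge. *)
Lemma leq_dist (f : T -> nat) (x y : T) :
  (forall u v, G u v -> f v <= (f u).+1) -> f y <= f x + dist G x y.
Proof.
move=> fstep; have [p xp [<- <-]] := geodesic x y.
elim: p x xp => [|z p IHp] x /=; first by rewrite addn0.
case/andP=> xz zp; apply: leq_trans (IHp z zp) _.
by rewrite addnS -addSn leq_add2r fstep.
Qed.

End Distance.

(** * Graphs all of whose edges are bridges *)

Section MinimallyConnected.
Variable T : finType.
Implicit Types (G H : sgraph T) (x y z v b c : T).
Local Open Scope nat_scope.

Definition same_edge x y : rel T :=
  fun u v => (u == x) && (v == y) || (u == y) && (v == x).

Lemma same_edge_sym x y : symmetric (same_edge x y).
Proof. by move=> u v; rewrite /same_edge orbC ![(v == _) && _]andbC. Qed.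

Fact del_edge_sym G x y : symmetric [rel u v | G u v && ~~ same_edge x y u v].
Proof. by move=> u v /=; rewrite adj_sym same_edge_sym. Qed.

Fact del_edge_irrefl G x y :
  irreflexive [rel u v | G u v && ~~ same_edge x y u v].
Proof. by move=> u /=; rewrite adj_irrefl. Qed.

Definition del_edge G x y : sgraph T :=
  SGraph (del_edge_sym G x y) (del_edge_irrefl G x y).

Fact add_edge_sym G x y :
  symmetric [rel u v | G u v || (u != v) && same_edge x y u v].
Proof. by move=> u v /=; rewrite adj_sym same_edge_sym eq_sym. Qed.

Fact add_edge_irrefl G x y :
  irreflexive [rel u v | G u v || (u != v) && same_edge x y u v].
Proof. by move=> u /=; rewrite adj_irrefl eqxx. Qed.

Definition add_edge G x y : sgraph T :=
  SGraph (add_edge_sym G x y) (add_edge_irrefl G x y).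

(** The branch of [G] hanging from [v] at [b] is hung from [c] instead. *)
Definition slide G v b c : sgraph T := add_edge (del_edge G v b) b c.

Lemma adj_neq G x y : G x y -> x != y.
Proof. by apply: contraTneq => ->; rewrite adj_irrefl. Qed.

Lemma connect_adjC G : connect_sym G.
Proof. by apply: sym_connect_sym; apply: adj_sym. Qed.

(** In a walk of [G], each passage along the lost edge from [x] to [y] is
replaced by a detour in [H]. *)
Lemma reconnected G H x y :
    connected_graph G -> connect H x y ->
    (forall u v, G u v -> ~~ same_edge x y u v -> H u v) ->
  connected_graph H.
Proof.
move=> Gc xy sub u v; apply: connect_sub (Gc u v) => {}u {}v uv.
case e: (same_edge x y u v); last by rewrite connect1 ?sub ?e.
case/orP: e => /andP[/eqP-> /eqP->] //.
by rewrite connect_adjC.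
Qed.

Definition minimally_connected G : Prop :=
  connected_graph G /\
  forall x y, G x y -> ~ connected_graph (del_edge G x y).

Variable G : sgraph T.
Hypothesis Gmin : minimally_connected G.
Let Gconn : connected_graph G := Gmin.1.

Lemma bridge x y : G x y -> ~~ connect (del_edge G x y) x y.
Proof.
move=> xy; apply/negP=> cxy; apply: (Gmin.2 _ _ xy).
by apply: reconnected cxy _ => // u v /= -> ->.
Qed.

(** A vertex [s] farthest from [r] is a leaf. Let [z] be a neighbour of [s] on
a geodesic from [r]. No geodesic from [r] needs another edge [s u]: it would not
enter [s] through it, by the choice of [z], nor leave [s] through it, since [u]
is not farther than [s]. So [s u] would not be a bridge. *)
Lemma leaf_exists :
  T -> exists s, forall w w', G s w -> G s w' -> w = w'.
Proof.
move=> r.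
have [s _ smax] := @arg_maxnP T r predT (dist G r) isT.
exists s; have [es|ns] := eqVneq r s.
  move=> w w' sw; have := smax w isT.
  rewrite -es /= distxx // leqn0 => /eqP/(dist_eq0 Gconn) er.
  by rewrite -er es adj_irrefl in sw.
have [z zs dz] := dist_pred Gconn ns.
suff{} uz u : G s u -> u = z by move=> w w' /uz-> /uz->.
move=> su; apply/eqP; apply: contraT => nuz.
have conn y : connect (del_edge G s u) r y.
  have [k] := ubnP (dist G r y); elim: k y => // k IHk y lt_yk.
  have [<-|ny] := eqVneq r y; first exact: connect0.
  (* If [y] is [s], step to [z]. Otherwise only the step from [u] to [s] uses
     the deleted edge, and [s] is at least as far from [r] as [u]. *)
  have [t ty dt] : exists2 t, del_edge G s u t y & dist G r y = (dist G r t).+1.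
    have [-> |nys] := eqVneq y s.
      exists z => //=; rewrite zs /same_edge eqxx andbT negb_or.
      by rewrite [z == u]eq_sym nuz andbT (negPf (adj_neq zs)).
    have [t ty dt] := dist_pred Gconn ny; exists t => //=.
    rewrite ty /same_edge (negPf nys) andbF orbF /=.
    apply/negP=> /andP[/eqP et /eqP ey]; have := smax y isT.
    by rewrite dt et /= ltnn.
  apply: connect_trans (IHk t _) (connect1 ty).
  by rewrite dt in lt_yk.
have /negP[] := bridge su.
by apply: connect_trans (conn u); rewrite connect_adjC.
Qed.

Definition branch v b : {pred T} := connect (del_edge G v b) b.

Lemma branchE v b x : (x \in branch v b) = connect (del_edge G v b) b x.
Proof. by []. Qed.

Lemma branch_root v b : b \in branch v b.
Proof. exact: connect0. Qed.

Lemma branch_apex v b : G v b -> v \notin branch v b.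
Proof.
by move=> vb; rewrite branchE connect_adjC bridge.
Qed.

Lemma branch_step v b y z :
  G v b -> G y z -> y \in branch v b -> z \notin branch v b -> y = b /\ z = v.
Proof.
move=> vb yz yB zB; case e: (same_edge v b y z).
  case/orP: e => /andP[/eqP ey /eqP ez] //.
  by move: (branch_apex vb); rewrite -[X in X \notin _]ey yB.
have /negP[] := zB; rewrite branchE; apply: connect_trans yB _.
by rewrite connect1 //= yz e.
Qed.

Lemma branch_const v b y z :
  G v b -> G y z -> ~~ same_edge v b y z ->
  (y \in branch v b) = (z \in branch v b).
Proof.
move=> vb yz; apply: contraNeq; rewrite /same_edge.
case yB: (y \in _); case zB: (z \in _) => // _.
  by have [-> ->] := branch_step vb yz yB (negbT zB); rewrite !eqxx orbT.
rewrite adj_sym in yz.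
by have [-> ->] := branch_step vb yz zB (negbT yB); rewrite !eqxx.
Qed.

(** The root [b] is outside the branch at [c], and a walk in the branch at [b]
could enter the branch at [c] only through [v], which is in neither. *)
Lemma branch_disjoint v b c x :
  G v b -> G v c -> b != c -> x \in branch v b -> x \notin branch v c.
Proof.
move=> vb vc nbc xB.
have bC : b \notin branch v c.
  apply/negP=> bC; have bv : G b v by rewrite adj_sym.
  have [ebc _] := branch_step vc bv bC (branch_apex vc).
  by rewrite ebc eqxx in nbc.
case/connectP: xB => p bp ->{x}.
set H := del_edge G v b in bp.
suff escape y : path H y p -> y \in branch v b -> y \notin branch v c ->
    last y p \notin branch v c.
  exact: escape bp (branch_root v b) bC.
elim: p y {bp} => //= z p IHp y.
case/andP=> /andP[yz nyz] zp yB yC.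
have zB : z \in branch v b by rewrite -(branch_const vb yz nyz).
apply: (IHp z) => //; apply/negP=> zC.
rewrite adj_sym in yz.
have [_ ey] := branch_step vc yz zC yC.
by move: (branch_apex vb); rewrite -[X in X \notin _]ey yB.
Qed.

(** Every walk from outside the branch to its root passes through [v]. In terms
of [leq_dist], the distance from [x] may be overwritten by the constant
[dist G x v + 1] on the branch and still grow by at most 1 along edges. *)
Lemma dist_root_out v b x :
  G v b -> x \notin branch v b -> dist G x b = (dist G x v).+1.
Proof.
move=> vb xB; apply/eqP; rewrite eqn_leq dist_step //=.
pose f y := if y \in branch v b then (dist G x v).+1 else dist G x y.
have := @leq_dist T G Gconn f x b.
rewrite /f branch_root (negPf xB) distxx // add0n; apply=> y z yz.
case: ifP => zB; case: ifP => yB; rewrite ?ltnS ?leqnSn ?dist_step //.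
  rewrite adj_sym in yz.
  by have [_ ->] := branch_step vb yz zB (negbT yB).
have [_ ->] := branch_step vb yz yB (negbT zB).
by rewrite leqW.
Qed.

Lemma dist_apex_in v b x :
  G v b -> x \in branch v b -> dist G x v = (dist G x b).+1.
Proof.
move=> vb xB; apply/eqP; rewrite eqn_leq dist_step 1?adj_sym //=.
pose f y := if y \in branch v b then dist G x y else (dist G x b).+1.
have := @leq_dist T G Gconn f x v.
rewrite /f xB (negPf (branch_apex vb)) distxx // add0n; apply=> y z yz.
case: ifP => zB; case: ifP => yB; rewrite ?ltnS ?leqnSn ?dist_step //.
  rewrite adj_sym in yz.
  by have [-> _] := branch_step vb yz zB (negbT yB); rewrite leqW.
by have [-> _] := branch_step vb yz yB (negbT zB).
Qed.

Lemma slide_connected v b c :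
  G v b -> G v c -> b != c -> connected_graph (slide G v b c).
Proof.
move=> vb vc nbc; apply: (@reconnected G _ v b) => //; last first.
  by move=> u w uw nuw; rewrite /= uw nuw.
apply: (@connect_trans _ _ c); apply: connect1 => /=.
  rewrite vc /same_edge eqxx [c == b]eq_sym (negPf nbc).
  by rewrite (negPf (adj_neq vb)).
by rewrite /same_edge !eqxx [c == b]eq_sym nbc !orbT.
Qed.

(** One plus the change in the distance between [x] and [y] caused by
[slide G v b c]: a change of -1, 0 or +1 is stored as 0, 1 or 2, to stay within
the natural numbers. *)
Definition shift v b c x y : nat :=
  if (x \in branch v b) (+) (y \in branch v b) then
    if (x \in branch v c) || (y \in branch v c) then 0 else 2
  else 1.

(** The left-hand side, as a function of [y], grows by at most 1 along every
edge of the new graph, so [leq_dist] applies. The shift can vary only along the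
edge from [v] to [c] and the new edge from [b] to [c], and there the bridges
[v b] and [v c] determine the distances by [dist_root_out] and [dist_apex_in].
*)
Lemma dist_slide v b c x y : G v b -> G v c -> b != c ->
  dist G x y + shift v b c x y <= (dist (slide G v b c) x y).+1.
Proof.
move=> vb vc nbc; pose f z := dist G x z + shift v b c x z.
have Sconn := slide_connected vb vc nbc.
have := @leq_dist _ _ Sconn f x y.
have -> : f x = 1 by rewrite /f distxx // /shift addbb.
rewrite add1n; apply=> {}y z yz; rewrite /f.
have ncb : c != b by rewrite eq_sym.
have bB := branch_root v b; have cC := branch_root v c.
have vB := negPf (branch_apex vb); have vC := negPf (branch_apex vc).
have bC := negPf (branch_disjoint vb vc nbc bB).
have cB := negPf (branch_disjoint vc vb ncb cC).
have xBC := @branch_disjoint v b c x vb vc nbc.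
have db := @dist_root_out v b x vb; have db' := @dist_apex_in v b x vb.
have dc := @dist_root_out v c x vc; have dc' := @dist_apex_in v c x vc.
case/orP: yz => [/andP[yz nyz]|/andP[_]].
  have eB := branch_const vb yz nyz.
  have dyz := dist_step Gconn x yz.
  case e: (same_edge v c y z); last first.
    have eC := branch_const vc yz (negbT e).
    by rewrite /shift eB eC -addSn leq_add2r.
  case/orP: e => /andP[/eqP-> /eqP->]; move: xBC db db' dc dc';
  rewrite /shift vB vC cB cC; case: (x \in branch v b);
  case: (x \in branch v c) => /=; clear; lia.
case/orP=> /andP[/eqP-> /eqP->]; move: xBC db db' dc dc';
  rewrite /shift bB bC cB cC; case: (x \in branch v b);
  case: (x \in branch v c) => /=; clear; lia.
Qed.

(** The losses and gains of the three cyclic slides cancel between two distinct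
branches, while between a branch and the rest of the graph there is only a gain;
the summand 1 records that gain for one pair, for later strictness. *)
Lemma dist_three_slides v b1 b2 b3 x y :
    G v b1 -> G v b2 -> G v b3 -> b1 != b2 -> b2 != b3 -> b3 != b1 ->
  dist G x y * 3 + ((x == v) && (y == b1)) <=
    dist (slide G v b1 b2) x y + dist (slide G v b2 b3) x y
    + dist (slide G v b3 b1) x y.
Proof.
move=> v1 v2 v3 n12 n23 n31.
have := dist_slide x y v1 v2 n12; have := dist_slide x y v2 v3 n23.
have := dist_slide x y v3 v1 n31.
suff: 3 + ((x == v) && (y == b1)) <=
    shift v b1 b2 x y + shift v b2 b3 x y + shift v b3 b1 x y by lia.
have [/andP[/eqP-> /eqP->]|_] := boolP (_ && _).
  have B1 := branch_root v b1.
  have B3 : b1 \notin branch v b3 by rewrite (branch_disjoint v1 v3) // eq_sym.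
  rewrite /shift (negPf (branch_apex v1)) (negPf (branch_apex v2)).
  rewrite (negPf (branch_apex v3)) B1 (negPf B3).
  by rewrite (negPf (branch_disjoint v1 v2 n12 B1)).
(* Given disjointness, the claim depends only on which branches contain [x]
   and [y]. *)
have dis z : [&& (z \in branch v b1) ==> (z \notin branch v b2),
    (z \in branch v b2) ==> (z \notin branch v b3) &
    (z \in branch v b3) ==> (z \notin branch v b1)].
  by apply/and3P; split; apply/implyP; apply: branch_disjoint.
move: (dis x) (dis y); rewrite /shift.
by do 3!case: (x \in _); do 3!case: (y \in _).
Qed.

End MinimallyConnected.

(** * Maximum degree two forces a path *)

Section Paths.
Local Open Scope nat_scope.
Variables (n : nat) (G : sgraph 'I_n).
Hypothesis Gmin : minimally_connected G.
Let Gconn : connected_graph G := Gmin.1.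

(** The hypothesis says that no vertex has three distinct neighbours. Starting
at a leaf [s], induction on the distance shows that no distance from [s] occurs
twice: the unique vertex at distance [k] has one neighbour at distance [k - 1],
hence at most one at distance [k + 1]; at [k = 0] this is because [s] is a
leaf. *)
Lemma max_degree2_path :
    (forall v b1 b2 b3, G v b1 -> G v b2 -> G v b3 ->
       [|| b1 == b2, b2 == b3 | b3 == b1]) ->
  is_path_graph G.
Proof.
move=> deg2.
case: (pickP 'I_n) => [r _|no]; last first.
  by exists id; [exists id|move=> x; have := no x].
have [s leaf] := leaf_exists Gmin r.
have dinj : injective (dist G s).
  move=> x; have [k] := ubnP (dist G s x); elim: k x => // k IHk x lt_xk y exy.
  have [sx|nsx] := eqVneq s x.
    by apply: dist_eq0 => //; rewrite -sx -exy -sx distxx.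
  have nsy : s != y.
    apply: contraNneq nsx => sy; apply/eqP; apply: (dist_eq0 Gconn).
    by rewrite exy -sy distxx.
  have [u ux du] := dist_pred Gconn nsx; have [w wy dw] := dist_pred Gconn nsy.
  have {w wy dw} uy : G u y.
    have -> // : u = w by apply: IHk; [rewrite du in lt_xk|lia].
  have [su|nsu] := eqVneq s u; first by apply: leaf; rewrite su.
  have [t tu dt] := dist_pred Gconn nsu; rewrite adj_sym in tu.
  have := deg2 u t x y tu ux uy; case/or3P=> /eqP // e.
    by move: du; rewrite -e dt; lia.
  by move: exy; rewrite e du dt; lia.
(* By injectivity, the neighbour of [y] preceding it on a geodesic from [s] is
   the only vertex at that distance; hence consecutive distances mean
   adjacency. *)
have lt_d x : dist G s x < n by rewrite -[n in _ < n]card_ord dist_lt_card.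
pose f x : 'I_n := Ordinal (lt_d x).
exists f; first by apply: injF_bij => x y [/dinj].
move=> x y; rewrite /= /path_adj /=; apply/idP/idP => [|xy].
  case/orP=> /eqP e; last rewrite adj_sym.
    have nsy : s != y by apply/negP=> /eqP sy; rewrite -sy distxx in e.
    have [u uy du] := dist_pred Gconn nsy.
    by have -> // : x = u by apply: dinj; lia.
  have nsx : s != x by apply/negP=> /eqP sx; rewrite -sx distxx in e.
  have [u ux du] := dist_pred Gconn nsx.
  by have -> // : y = u by apply: dinj; lia.
have yx : G y x by rewrite adj_sym.
have nxy : dist G s x != dist G s y by rewrite (inj_eq dinj) (adj_neq xy).
have := dist_step Gconn s xy; have := dist_step Gconn s yx; lia.
Qed.

End Paths.

(** * Graphs maximizing the weighted sum of distances *)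

Section Extremal.
Variables (R : realDomainType) (T : finType).
Implicit Types (D : T -> T -> nat) (w : T -> T -> R) (G H : sgraph T).

Definition wsum w D : R := \sum_x \sum_y (D x y)%:R * w x y.

Lemma ler_wsum w D D' :
  (forall x y, 0 <= w x y) -> (forall x y, D x y <= D' x y)%N ->
  wsum w D <= wsum w D'.
Proof.
move=> w0 leD; apply: ler_sum => x _; apply: ler_sum => y _.
by rewrite ler_wpM2r ?w0 // ler_nat.
Qed.

Lemma wsumD w D D' :
  wsum w (fun x y => D x y + D' x y)%N = wsum w D + wsum w D'.
Proof.
rewrite /wsum -big_split; apply: eq_bigr => x _ /=.
by rewrite -big_split; apply: eq_bigr => y _ /=; rewrite natrD mulrDl.
Qed.

Lemma wsum_delta w x0 y0 :
  wsum w (fun x y => (x == x0) && (y == y0) : nat) = w x0 y0.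
Proof.
rewrite /wsum (bigD1 x0) //= (bigD1 y0) //= !eqxx mul1r.
rewrite !big1 ?addr0 //.
  by move=> x /negPf nx; rewrite big1 // => y _; rewrite nx mul0r.
by move=> y /negPf ny; rewrite ny mul0r.
Qed.

Lemma eq_wsum w D D' : D =2 D' -> wsum w D = wsum w D'.
Proof.
by move=> eD; apply: eq_bigr => x _; apply: eq_bigr => y _; rewrite eD.
Qed.

(** Maximality for the lexicographic order on the pair formed by the
[w]-weighted and the unweighted sum of distances. *)
Definition extremal w H : Prop :=
  connected_graph H /\ forall K, connected_graph K ->
    wsum w (dist K) <= wsum w (dist H) /\
    (wsum w (dist K) = wsum w (dist H) ->
     wsum (fun _ _ => 1) (dist K) <= wsum (fun _ _ => 1) (dist H)).

(** Graphs contain proofs and so do not form a finite type; to maximize over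
them, they are coded by arbitrary finite boolean functions, each of which is
symmetrized and stripped of its diagonal. *)
Definition code_rel (g : {ffun T * T -> bool}) : rel T :=
  fun x y => (x != y) && (g (x, y) || g (y, x)).

Fact code_rel_sym g : symmetric (code_rel g).
Proof. by move=> x y; rewrite /code_rel eq_sym orbC. Qed.

Fact code_rel_irrefl g : irreflexive (code_rel g).
Proof. by move=> x; rewrite /code_rel eqxx. Qed.

Definition decode g : sgraph T := SGraph (code_rel_sym g) (code_rel_irrefl g).

Definition code G : {ffun T * T -> bool} := [ffun e => G e.1 e.2].

Lemma codeK G : decode (code G) =2 G.
Proof.
move=> x y; rewrite /= /code_rel !ffunE /= [G y x]adj_sym orbb.
by apply: andb_idl => /adj_neq.
Qed.

Lemma extremal_exists w G :
  connected_graph G ->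
  exists2 H, extremal w H & wsum w (dist G) <= wsum w (dist H).
Proof.
move=> Gc; pose conn g := [forall x, forall y, connect (decode g) x y].
have connP g : reflect (connected_graph (decode g)) (conn g).
  by apply: (iffP forallP) => h x; apply/forallP; apply: h.
have code_conn K : connected_graph K -> conn (code K).
  by move=> Kc; apply/connP=> x y; rewrite (eq_connect (codeK K)).
pose W v g := wsum v (dist (decode g)).
have W_code v K : W v (code K) = wsum v (dist K).
  by apply: eq_wsum; apply: eq_dist; apply: codeK.
case: (@Order.TotalTheory.arg_maxP _ R _ (code G) conn (W w))
  => [|g0 g0c g0max].
  exact: code_conn.
pose opt g := conn g && (W w g == W w g0).
case: (@Order.TotalTheory.arg_maxP _ R _ g0 opt (W (fun _ _ => 1))).
  by rewrite /opt g0c eqxx.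
move=> g /andP[gc /eqP eg] gmax.
exists (decode g); last first.
  by rewrite -W_code -[X in _ <= X]/(W w g) eg; apply: g0max (code_conn _ Gc).
split=> [|K Kc]; first exact/connP.
rewrite -!(W_code _ K) -!/(W _ g).
split; first by rewrite eg; apply: g0max (code_conn _ Kc).
by move=> eK; apply: gmax; rewrite /opt code_conn //= eK eg.
Qed.

Variables (w : T -> T -> R) (H : sgraph T).
Hypotheses (w_ge0 : forall x y, 0 <= w x y) (Hext : extremal w H).

(** If deleting [x y] left the graph connected, no distance would decrease and
that between [x] and [y] would increase, against the tie-break. *)
Lemma extremal_minimal : minimally_connected H.
Proof.
have [Hc Hmax] := Hext; split=> // x y xy Kc; set K := del_edge H x y in Kc.
have leHK u v : (dist H u v + ((u == x) && (v == y)) <= dist K u v)%N.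
  have le_d : (dist H u v <= dist K u v)%N.
    have := leq_dist (f := dist H u) Kc u v; rewrite distxx // add0n; apply.
    by move=> a b /andP[ab _]; apply: dist_step.
  have [/andP[/eqP eu /eqP ev]|_] := boolP (_ && _); last by rewrite addn0.
  rewrite eu ev in le_d *; have nxy := adj_neq xy.
  have [z zy ->] := dist_pred Kc nxy; rewrite addn1 ltnS.
  have dxy : (dist H x y <= 1)%N.
    by rewrite (leq_trans (dist_step Hc x xy)) // distxx.
  have := @dist_eq0 _ _ Kc x z; case: (dist K x z) => [/(_ erefl) xz|k _].
    by move: zy; rewrite -xz /= /same_edge !eqxx andbF.
  exact: leq_trans dxy _.
have le_w v : (forall a b, 0 <= v a b) ->
    wsum v (dist H) + v x y <= wsum v (dist K).
  by move=> v0; rewrite -wsum_delta -wsumD; apply: ler_wsum.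
have [le1 le2] := Hmax K Kc.
have eKH : wsum w (dist K) = wsum w (dist H).
  by have := le_w w w_ge0; have := w_ge0 x y; lra.
have := le_w (fun _ _ => 1) (fun _ _ => ler01); have := le2 eKH; lra.
Qed.

(** The three slid graphs have total weighted sum at least three times that of
[H], yet each has at most that of [H]; so all tie, and the tie-break contradicts
the strict gain at the pair [v], [b1]. *)
Lemma extremal_degree v b1 b2 b3 :
  H v b1 -> H v b2 -> H v b3 -> [|| b1 == b2, b2 == b3 | b3 == b1].
Proof.
move=> v1 v2 v3; apply: contraT; rewrite !negb_or => /and3P[n12 n23 n31].
have Hmin := extremal_minimal; have [Hc Hmax] := Hext.
set K1 := slide H v b1 b2; set K2 := slide H v b2 b3.
set K3 := slide H v b3 b1.
have le_w u : (forall a b, 0 <= u a b) ->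
    wsum u (dist H) * 3 + u v b1 <=
      wsum u (dist K1) + wsum u (dist K2) + wsum u (dist K3).
  move=> u0; have -> : wsum u (dist H) * 3 =
      wsum u (dist H) + wsum u (dist H) + wsum u (dist H) by ring.
  rewrite -wsum_delta -!wsumD; apply: ler_wsum => // x y.
  have := dist_three_slides Hmin x y v1 v2 v3 n12 n23 n31.
  by rewrite -/K1 -/K2 -/K3; lia.
have [le1 eq1] := Hmax K1 (slide_connected Hmin v1 v2 n12).
have [le2 eq2] := Hmax K2 (slide_connected Hmin v2 v3 n23).
have [le3 eq3] := Hmax K3 (slide_connected Hmin v3 v1 n31).
have := le_w w w_ge0; have := w_ge0 v b1 => wv sw.
have e1 := eq1 ltac:(lra); have e2 := eq2 ltac:(lra).
have e3 := eq3 ltac:(lra).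
have := le_w (fun _ _ => 1) (fun _ _ => ler01); lra.
Qed.

End Extremal.

Theorem theorem4 (R : realType) (n : nat) (G : sgraph 'I_n) (A : 'M[R]_n)
    (Gconn : connected_graph G)
    (Asym : A^T = A)
    (Age0 : forall i j : 'I_n, 0 <= A i j) :
  exists2 P : sgraph 'I_n,
    is_path_graph P &
    \sum_(i < n) \sum_(j < n | (i < j)%N) (dist G i j)%:R * A i j
      <= \sum_(i < n) \sum_(j < n | (i < j)%N) (dist P i j)%:R * A i j.
Proof.
(* Each unordered pair is counted once, so the weight is cut off below the
   diagonal to sum over all ordered pairs. *)
pose w (i j : 'I_n) : R := if (i < j)%N then A i j else 0.
have w_ge0 i j : 0 <= w i j by rewrite /w; case: ifP.
have wsumE (H : sgraph 'I_n) :
    \sum_(i < n) \sum_(j < n | (i < j)%N) (dist H i j)%:R * A i j =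
      wsum w (dist H).
  apply: eq_bigr => i _; rewrite big_mkcond; apply: eq_bigr => j _.
  by rewrite /w; case: ifP => // _; rewrite mulr0.
have [P Pext leGP] := extremal_exists w Gconn.
exists P; last by rewrite !wsumE.
apply: max_degree2_path (extremal_minimal w_ge0 Pext) _.
exact: extremal_degree w_ge0 Pext.
Qed.
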